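(* Let $X$ be a nonempty set, let $a\in X$, and let $\tau$ and $\sigma$ be metrizable topologies on $X$ with $\tau|_{X\setminus\{a\}}=\sigma|_{X\setminus\{a\}}$ (equality of the subspace topologies on $X\setminus\{a\}$; no inclusion between $\tau$ and $\sigma$ is assumed). Then: (i) $\mathcal B(X,\tau)=\mathcal B(X,\sigma)$; (ii) $(X,\tau)$ is completely metrizable if and only if $(X,\sigma)$ is completely metrizable; (iii) $(X,\tau)$ is Polish if and only if $(X,\sigma)$ is Polish.
   Context: $\mathcal B(X,\nu)$ denotes the Borel $\sigma$-algebra of the topological space $(X,\nu)$. *)

(* Defs.v *)
From HB Require Import structures.
From mathcomp Require Import all_boot all_order all_algebra.
From mathcomp Require Import all_classical all_reals all_analysis.

Set Implicit Arguments.
Unset Strict Implicit.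
Unset Printing Implicit Defensive.

Local Open Scope classical_set_scope.
Local Open Scope ring_scope.

(* Several topologies live on the same carrier, so a topology on X is taken as
   an element of the topologicalType class over X; likewise a metric on X is an
   element of the metricType class. Both classes contain a choice operator on
   X, which is independent of the topology and plays no role. *)
Definition topology (X : Type) : Type := Topological.axioms_ X.

Definition space (X : Type) (tau : topology X) : topologicalType :=
  Topological.Pack tau.

Definition metric (R : realType) (X : Type) : Type := Metric.axioms_ R X.

Definition metric_space (R : realType) (X : Type) (m : metric R X) :
  metricType R := Metric.Pack m.

Definition opens (X : Type) (tau : topology X) : set (set X) :=
  @open (space tau).

Definition metric_opens (R : realType) (X : Type) (m : metric R X) :
  set (set X) := @open (metric_space m).

(* The subspace topology on A, as a family of subsets of X contained in A. *)
Definition subspace_opens (X : Type) (tau : topology X) (A : set X) :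
  set (set X) := [set U `&` A | U in opens tau].

Definition borel (X : Type) (tau : topology X) : set (set X) := <<s opens tau >>.

Definition metrizable (R : realType) (X : Type) (tau : topology X) : Prop :=
  exists m : metric R X, metric_opens m = opens tau.

(* The axiom of completeType, whose class also demands a base point; it is
   stated with an explicit limit because lim needs that base point. *)
Definition complete (T : uniformType) : Prop :=
  forall F : set_system T, ProperFilter F -> cauchy F -> exists x : T, F --> x.

Definition completely_metrizable (R : realType) (X : Type) (tau : topology X) :
    Prop :=
  exists m : metric R X,
    metric_opens m = opens tau /\ complete (metric_space m).

Definition separable (T : topologicalType) : Prop :=
  exists D : set T, countable D /\ dense D.

Definition polish (R : realType) (X : Type) (tau : topology X) : Prop :=
  separable (space tau) /\ completely_metrizable R tau.

(* Main.v *)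
Require Import Defs.
From HB Require Import structures.
From mathcomp Require Import all_boot all_order all_algebra.
From mathcomp Require Import all_classical all_reals all_analysis.
From mathcomp Require Import ring lra.

Set Implicit Arguments.
Unset Strict Implicit.
Unset Printing Implicit Defensive.

Import Order.TTheory GRing.Theory Num.Theory.
Import numFieldNormedType.Exports.

Local Open Scope classical_set_scope.
Local Open Scope ring_scope.

(** Since points are closed in both topologies, a set missing [a] is open for
one topology as soon as it is open for the other ([opens_subspaceC1]). Two of
the claims follow quickly. An open set of [sigma] containing [a] is the union of
a [tau]-open set and the closed point [a], so the Borel sets agree
([borel_sub]); and a countable [tau]-dense set becomes [sigma]-dense once [a] is
added to it ([separable_transfer]).

Complete metrizability is the substantial claim. Let [m] be a complete metric
for [tau] and [n] any metric for [sigma]. The open subspace away from [a] is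
completely metrized by [m x y + |1 / m a x - 1 / m a y|]: the second term stops
a Cauchy filter from running to [a] in the sense of [tau], which would say
nothing about [sigma]. Let [e] be this distance truncated at 1 and let
[h x = n a x]. The complete metric for [sigma] is the cone over the punctured
space, with apex [a] and height [h]:
  [|h x - h y| + min (h x) (h y) * e x y].
Near the apex only the height counts, and the height is the [sigma]-distance to
[a]; away from the apex the height is locally bounded below, so the cone metric
has the topology of [e], which is the common topology of [tau] and [sigma]
([glued_metric_opens]). Along a Cauchy filter the height converges. If the limit
is 0, the filter converges to [a]; otherwise it is Cauchy for [e], hence has an
[m]-limit different from [a], which is also its limit for the cone metric
([glued_metric_complete]). *)

(** * Metrics as distance functions *)

(** Stated on [X] itself, so that distances of several metrics on the same
carrier can be compared. *)
Definition dist (R : realType) (X : Type) (m : metric R X) (x y : X) : R :=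
  @mdist R (metric_space m) x y.

Lemma mdist_lipschitz (R : realFieldType) (T : metricType R) (a x y : T) :
  `|mdist a x - mdist a y| <= mdist x y.
Proof.
have := metric_triangle a x y; have := metric_triangle a y x.
by rewrite (metric_sym y x) ler_norml; lra.
Qed.

Lemma near_inv_mdist (R : realType) (T : metricType R) (a x : T) (r : R) :
  a <> x -> 0 < r -> \forall y \near x, `|(mdist a x)^-1 - (mdist a y)^-1| < r.
Proof.
move=> ax r0.
have distx : mdist a y @[y --> x] --> mdist a x.
  apply/cvgrPdist_lt => /= t t0; apply/nbhs_ballP; exists t => // y.
  by rewrite ballEmdist; exact/le_lt_trans/mdist_lipschitz.
apply: cvgr_dist_lt r0; apply: cvgV distx.
by apply/eqP => /mdist_positivity.
Qed.

Section MetricOfDist.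
Context (R : realType) (X : Type).

Record is_dist (d : X -> X -> R) : Prop := IsDist {
  is_dist_xx : forall x, d x x = 0;
  is_dist_eq : forall x y, d x y = 0 -> x = y;
  is_dist_sym : forall x y, d x y = d y x;
  is_dist_triangle : forall y x z, d x z <= d x y + d y z }.

(** The proof is an argument of the alias so that the metric structure below can
be inferred from the type alone. *)
Definition dist_space (d : X -> X -> R) (dP : is_dist d) : Type := X.

HB.instance Definition _ d dP := gen_eqMixin (@dist_space d dP).
HB.instance Definition _ d dP := gen_choiceMixin (@dist_space d dP).
HB.instance Definition _ d (dP : is_dist d) :=
  isMetric.Build R (dist_space dP)
    (is_dist_xx dP) (is_dist_eq dP) (is_dist_sym dP) (is_dist_triangle dP).

Definition metric_of_dist d (dP : is_dist d) : metric R X :=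
  Metric.class (dist_space dP : metricType R).

End MetricOfDist.

Section Dist.
Context (R : realType) (X : Type).
Implicit Types (m n : metric R X) (x y z a : X) (A U : set X).

Lemma distxx m x : dist m x x = 0.
Proof. exact: (@mdistxx _ (metric_space m)). Qed.

Lemma dist_ge0 m x y : 0 <= dist m x y.
Proof. exact: (@mdist_ge0 _ (metric_space m)). Qed.

Lemma dist_eq0 m x y : dist m x y = 0 -> x = y.
Proof. exact: (@mdist_positivity _ (metric_space m)). Qed.

Lemma dist_gt0 m x y : x <> y -> 0 < dist m x y.
Proof.
move=> xy; rewrite lt_neqAle dist_ge0 andbT eq_sym.
by apply/eqP => /dist_eq0.
Qed.

Lemma distC m x y : dist m x y = dist m y x.
Proof. exact: (@metric_sym _ (metric_space m)). Qed.

Lemma dist_triangle m y x z : dist m x z <= dist m x y + dist m y z.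
Proof. exact: (@metric_triangle _ (metric_space m)). Qed.

Lemma dist_lipschitz m a x y : `|dist m a x - dist m a y| <= dist m x y.
Proof. exact: (@mdist_lipschitz _ (metric_space m)). Qed.

Lemma nbhs_distP m x A : @nbhs _ (metric_space m) x A <->
  exists2 e : R, 0 < e & forall y, dist m x y < e -> A y.
Proof.
rewrite nbhs_ballP; split=> -[e e0 eA]; exists e => //.
  by move=> y xy; apply: eA; rewrite ballEmdist.
by move=> y; rewrite ballEmdist; apply: eA.
Qed.

Lemma metric_opensP m U : metric_opens m U <->
  forall x, U x -> @nbhs _ (metric_space m) x U.
Proof. by rewrite /metric_opens openE. Qed.

Lemma metric_opens_eq m n :
  (forall x A, @nbhs _ (metric_space m) x A <-> @nbhs _ (metric_space n) x A) ->
  metric_opens m = metric_opens n.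
Proof.
move=> mn; apply/seteqP; split=> U /metric_opensP Uo; apply/metric_opensP => x.
  by move/Uo/mn.
by move/Uo/mn.
Qed.

Lemma metric_opensC1 m a : metric_opens m (~` [set a]).
Proof.
apply/metric_opensP => x xa; apply/nbhs_distP.
exists (dist m x a); first exact: dist_gt0.
by move=> y + ya; rewrite ya ltxx.
Qed.

Lemma complete_distP m : complete (metric_space m) <->
  forall F : set_system X, ProperFilter F ->
    (forall e : R, 0 < e -> \forall x & y \near F, dist m x y < e) ->
    exists x, forall e : R, 0 < e -> \forall y \near F, dist m x y < e.
Proof.
split=> mc F FF.
  move=> Fc; have [|x Fx] := mc F FF.
    apply/cauchy_ballP => e /Fc; apply: filter_app.
    by near=> z; rewrite ballEmdist.
  exists x => e e0; by apply: Fx; apply/nbhs_distP; exists e.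
move/(@cauchy_ballP R (metric_space m)) => Fc.
have [|x Fx] := mc F FF.
  move=> e /Fc; apply: filter_app.
  by near=> z; rewrite ballEmdist.
exists x => A /nbhs_distP[e /Fx + eA].
by apply: filterS.
Unshelve. all: by end_near. Qed.

End Dist.

(** * The cone metric *)

Section Cone.
Context (R : realType) (X : Type) (h : X -> R) (e : X -> X -> R).
Hypothesis h_ge0 : forall x, 0 <= h x.
Hypothesis e_ge0 : forall x y, 0 <= e x y.
Hypothesis e_le1 : forall x y, e x y <= 1.
Hypothesis exx : forall x, e x x = 0.
Hypothesis e_sym : forall x y, e x y = e y x.
Hypothesis e_triangle : forall y x z, e x z <= e x y + e y z.
Hypothesis he_eq : forall x y, h x = h y -> h x = 0 \/ e x y = 0 -> x = y.

(** The cone over a space of diameter at most 1, in coordinates: [h x] is the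
distance of [x] to the apex, and [e] is the distance on the base. *)
Definition cone_dist x y := `|h x - h y| + Num.min (h x) (h y) * e x y.

Let minh_ge0 x y : 0 <= Num.min (h x) (h y).
Proof. by rewrite le_min !h_ge0. Qed.

Let cone_sym x y : cone_dist x y = cone_dist y x.
Proof. by rewrite /cone_dist distrC minC e_sym. Qed.

(* If [y] is at least as high as the lower of [x] and [z], replacing
   [min (h x) (h z)] by the two other minima only increases the weights of [e].
   If [y] is lower, the detour costs [2 * (h x - h y)] in height, and it gains
   at most [(h x - h y) * e x z], which [e <= 1] makes smaller. *)
Let cone_triangle_le y x z : h x <= h z ->
  cone_dist x z <= cone_dist x y + cone_dist y z.
Proof.
move=> xz; rewrite /cone_dist (min_l xz).
have xy0 := e_ge0 x y; have yz0 := e_ge0 y z; have xyz := e_triangle y x z.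
have [yx|xy] := leP (h y) (h x).
  rewrite (min_l (le_trans yx xz)).
  have xz1 := e_le1 x z; have := h_ge0 y.
  rewrite (ler0_norm (x := h x - h z)) ?subr_le0//.
  rewrite (ger0_norm (x := h x - h y)) ?subr_ge0//.
  rewrite (ler0_norm (x := h y - h z)) ?subr_le0 ?(le_trans yx)//.
  by nra.
have xm : h x <= Num.min (h y) (h z) by rewrite le_min (ltW xy).
rewrite addrACA lerD ?ler_distD//.
have hx := h_ge0 x.
by nra.
Qed.

Lemma cone_is_dist : is_dist cone_dist.
Proof.
split.
- by move=> x; rewrite /cone_dist subrr normr0 exx mulr0 addr0.
- move=> x y /eqP; rewrite /cone_dist paddr_eq0 ?mulr_ge0//.
  rewrite normr_eq0 subr_eq0 mulf_eq0 => /andP[/eqP hxy].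
  rewrite -hxy minxx => he; apply: he_eq => //.
  by case/orP: he => /eqP; [left|right].
- exact: cone_sym.
- move=> y x z; have [|/ltW] := leP (h x) (h z); first exact: cone_triangle_le.
  rewrite (cone_sym x z) (cone_sym x y) (cone_sym y z) addrC.
  exact: cone_triangle_le.
Qed.

End Cone.

(** * Gluing a metric off a point to a metric at that point *)

Section Transfer.
Context (R : realType) (X : Type) (a : X) (m n : metric R X).
Hypothesis nbhs_mn : forall x A, x <> a ->
  @nbhs _ (metric_space m) x A <-> @nbhs _ (metric_space n) x A.

(* The junk value [0^-1 = 0] at [x = a] is harmless: in the cone distance to the
   apex, [inv] only occurs multiplied by the height 0. *)
Let inv x := (dist m a x)^-1.
Let height := dist n a.

(** The second term blows up near [a], so that completeness of [m] gives
completeness of this distance away from [a]; the truncation at 1 is what the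
cone construction asks of its base. *)
Definition punctured_dist x y :=
  Num.min 1 (dist m x y + `|inv x - inv y|).

Let e := punctured_dist.

Let punctured_dist_ge0 x y : 0 <= e x y.
Proof. by rewrite le_min ler01 addr_ge0 ?dist_ge0. Qed.

Let punctured_distxx x : e x x = 0.
Proof.
by rewrite /e /punctured_dist distxx subrr normr0 addr0 min_r.
Qed.

Let punctured_dist_sym x y : e x y = e y x.
Proof. by rewrite /e /punctured_dist distC distrC. Qed.

Let punctured_dist_triangle y x z : e x z <= e x y + e y z.
Proof.
have := dist_triangle m y x z; have := ler_distD (inv y) (inv x) (inv z).
have := dist_ge0 m x y; have := dist_ge0 m y z.
have := normr_ge0 (inv x - inv y); have := normr_ge0 (inv y - inv z).
rewrite /e /punctured_dist; move=> *.
case: (leP 1 (dist m x y + _)); case: (leP 1 (dist m y z + _)) => *;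
  rewrite ge_min; apply/orP; lra.
Qed.

Let minh_ge0 x y : 0 <= Num.min (height x) (height y).
Proof. by rewrite le_min !dist_ge0. Qed.

Let height_eq x y : height x = height y -> height x = 0 \/ e x y = 0 -> x = y.
Proof.
move=> xy [x0|].
  by rewrite -(dist_eq0 x0); apply: (@dist_eq0 _ _ n); rewrite -/height -xy.
rewrite /e /punctured_dist; case: leP => [_ /eqP|_ /eqP].
  by rewrite oner_eq0.
by rewrite paddr_eq0 ?dist_ge0// => /andP[/eqP/(@dist_eq0 _ _ m)].
Qed.

Let glued_is_dist : is_dist (cone_dist height e).
Proof.
apply: cone_is_dist => //; first exact: dist_ge0.
by move=> x y; rewrite ge_min lexx.
Qed.

Definition glued_metric : metric R X := metric_of_dist glued_is_dist.

Let gluedE x y : dist glued_metric x y =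
  `|height x - height y| + Num.min (height x) (height y) * e x y.
Proof. by []. Qed.

Let glued_apex y : dist glued_metric a y = dist n a y.
Proof.
by rewrite gluedE /height distxx sub0r normrN min_l ?dist_ge0// mul0r addr0
  ger0_norm ?dist_ge0.
Qed.

Let near_punctured_dist x r : x <> a -> 0 < r ->
  \forall y \near (x : metric_space n), e x y < r.
Proof.
move=> xa r0; apply/(nbhs_mn _ xa).
have r2 : 0 < r / 2 by rewrite divr_gt0.
have xr : \forall y \near (x : metric_space m), dist m x y < r / 2.
  by apply/nbhs_distP; exists (r / 2).
have := @near_inv_mdist R (metric_space m) a x _ (nesym xa) r2.
apply: filterS2 xr => y xy ixy.
by rewrite gt_min [X in _ || X](_ : _ = true) ?orbT// (splitr r) ltrD.
Qed.

(* Above height [c], small cone distance gives small base distance; [r <= 1]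
   lets the truncation be removed. *)
Let punctured_dist_lt c r x y : 0 < c -> r <= 1 ->
  c < height x -> c < height y -> dist glued_metric x y < c * r ->
  dist m x y + `|inv x - inv y| < r.
Proof.
move=> c0 r1 cx cy; rewrite gluedE => xy.
have cxy : c < Num.min (height x) (height y) by rewrite lt_min cx.
have : e x y < r.
  have := normr_ge0 (height x - height y); have := punctured_dist_ge0 x y.
  by move=> *; nra.
by rewrite gt_min ltNge r1.
Qed.

Let glued_nbhs x A :
  @nbhs _ (metric_space glued_metric) x A <-> @nbhs _ (metric_space n) x A.
Proof.
have [->|xa] := pselect (x = a).
  by split=> /nbhs_distP[r r0 rA]; apply/nbhs_distP; exists r => // y;
    have := rA y; rewrite glued_apex.
have hx0 : 0 < height x by apply: dist_gt0; exact: nesym.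
split.
  move=> /nbhs_distP[r r0 rA].
  have r2 : 0 < r / 2 by rewrite divr_gt0.
  have near1 : \forall y \near (x : metric_space n), dist n x y < r / 2.
    by apply/nbhs_distP; exists (r / 2).
  have := near_punctured_dist xa (divr_gt0 r2 hx0).
  apply: filterS2 near1 => y xy exy; apply: rA.
  rewrite gluedE (splitr r); apply: ltrD.
    exact: le_lt_trans (dist_lipschitz _ _ _ _) xy.
  move: exy; rewrite ltr_pdivlMr// mulrC; apply: le_lt_trans.
  by rewrite ler_wpM2r// ge_min lexx.
move=> /(nbhs_mn _ xa)/nbhs_distP[r r0 rA].
pose s := Num.min 1 r.
have s0 : 0 < s by rewrite lt_min ltr01.
have s1 : s <= 1 by rewrite ge_min lexx.
(* a cone ball of radius at most [height x / 2] stays above height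
   [height x / 2], where [punctured_dist_lt] applies *)
apply/nbhs_distP; exists (height x / 2 * s).
  by rewrite mulr_gt0// divr_gt0.
move=> y xy; apply: rA.
have hy : height x / 2 < height y.
  have := mulr_ge0 (minh_ge0 x y) (punctured_dist_ge0 x y).
  have := ler_norm (height x - height y).
  by move: xy; rewrite gluedE => *; nra.
have hx : height x / 2 < height x by lra.
have /punctured_dist_lt/(_ s1 hx hy xy) : 0 < height x / 2 by rewrite divr_gt0.
rewrite lt_min => /andP[_]; apply: le_lt_trans.
by rewrite lerDl.
Qed.

Lemma glued_metric_opens : metric_opens glued_metric = metric_opens n.
Proof. exact: metric_opens_eq glued_nbhs. Qed.

(** The height is 1-Lipschitz, hence converges along a Cauchy filter; whether
its limit is zero decides between convergence to the apex and convergence for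
[m] away from the apex. *)
Lemma glued_metric_complete :
  complete (metric_space m) -> complete (metric_space glued_metric).
Proof.
move=> /complete_distP mc; apply/complete_distP => F FF Fc.
have hF : height y @[y --> F] --> lim (height y @[y --> F]).
  apply: R_complete.
  apply/cauchy_ballP => t /Fc Ft.
  rewrite near_map2; apply: filterS Ft => -[x y] /=.
  rewrite gluedE /ball/=; apply: le_lt_trans.
  by rewrite lerDl mulr_ge0 ?punctured_dist_ge0.
set L := lim _ in hF.
have L0 : 0 <= L.
  apply: (limr_ge hF).
  by near=> y; exact: dist_ge0.
have nearL t : 0 < t -> \forall y \near F, `|L - height y| < t.
  exact: cvgr_dist_lt.
have [L_eq0|L_neq0] := eqVneq L 0.
  exists a => t /nearL; apply: filterS => y.
  by rewrite glued_apex L_eq0 sub0r normrN ger0_norm// dist_ge0.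
have {L_neq0}L_gt0 : 0 < L by rewrite lt_def L_neq0.
have L2 : 0 < L / 2 by rewrite divr_gt0.
have hL : \forall y \near F, L / 2 < height y.
  by apply: filterS (nearL _ L2) => y; rewrite ltr_distlC => /andP[+ _]; lra.
have Fpunctured r : 0 < r -> \forall x & y \near F,
    dist m x y + `|inv x - inv y| < r.
  move=> r0; pose s := Num.min 1 r.
  have s0 : 0 < s by rewrite lt_min ltr01.
  have s1 : s <= 1 by rewrite ge_min lexx.
  have := Fc _ (mulr_gt0 L2 s0).
  have hL2 : \forall x & y \near F, L / 2 < height x /\ L / 2 < height y.
    by exists ([set y | L / 2 < height y], [set y | L / 2 < height y]).
  apply: filterS2 hL2 => -[x y] /= [hx hy] xy.
  by have := punctured_dist_lt L2 s1 hx hy xy; rewrite lt_min => /andP[].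
have [x Fx] : exists x, forall r : R, 0 < r ->
    \forall y \near F, dist m x y < r.
  apply: mc => r /Fpunctured; apply: filterS => -[x y] /=; apply: le_lt_trans.
  by rewrite lerDl.
have xa : x <> a.
  move=> xa; rewrite {}xa in Fx.
  (* if the [m]-limit were [a], then [inv] would be unbounded along the filter,
     although it is Cauchy *)
  have [[P Q] /= [FP FQ] PQ] := Fpunctured _ ltr01.
  have [y Py] := filter_ex FP.
  have y1 : 0 < `|inv y| + 1 by apply: ltr_wpDl.
  have r0 : 0 < (`|inv y| + 1)^-1 by rewrite invr_gt0.
  have [z [[Qz hz] az]] := filter_ex (filterI (filterI FQ hL) (Fx _ r0)).
  have az0 : 0 < dist m a z.
    apply: dist_gt0 => az_eq; move: hz.
    by rewrite -az_eq /height distxx ltNge ltW.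
  have yz : `|inv y - inv z| < 1.
    by apply: le_lt_trans (PQ (y, z) _) => //=; rewrite lerDr dist_ge0.
  move: az; rewrite -[dist m a z]invrK ltf_pV2 ?posrE ?invr_gt0//.
  have := ler_norm (inv y); have := ler_norm (inv z - inv y).
  by move: yz; rewrite distrC /inv; lra.
exists x => r r0.
have [t t0 tr] : exists2 t : R, 0 < t & forall y, dist m x y < t ->
    dist glued_metric x y < r.
  by apply/nbhs_distP/(nbhs_mn _ xa)/glued_nbhs/nbhs_distP; exists r.
by apply: filterS (Fx _ t0).
Unshelve. all: by end_near. Qed.

End Transfer.

(** * Topologies that agree off a point *)

Section AwayFromPoint.
Context (R : realType) (X : Type) (a : X).
Implicit Types tau sigma : topology X.

Lemma opensI tau (U V : set X) :
  opens tau U -> opens tau V -> opens tau (U `&` V).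
Proof. by move=> oU oV; exact: (@openI (Defs.space tau)). Qed.

Lemma metrizable_opensC1 tau : metrizable R tau -> opens tau (~` [set a]).
Proof. by move=> [m <-]; exact: metric_opensC1. Qed.

Lemma opens_subspaceC1 tau sigma (U : set X) :
  opens sigma (~` [set a]) ->
  subspace_opens tau (~` [set a]) = subspace_opens sigma (~` [set a]) ->
  ~ U a -> opens tau U -> opens sigma U.
Proof.
move=> oa ts Ua oU.
have UE : U `&` ~` [set a] = U.
  by apply/setIidl => x Ux xa; rewrite xa in Ux.
have : subspace_opens tau (~` [set a]) U by exists U.
by rewrite ts => -[V oV <-]; exact: opensI.
Qed.

Lemma borel_sub tau sigma :
  opens tau (~` [set a]) -> opens sigma (~` [set a]) ->
  (forall U, ~ U a -> opens sigma U -> opens tau U) ->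
  borel sigma `<=` borel tau.
Proof.
move=> oa oa' st; have [b0 bD bU] := smallest_sigma_algebra setT (opens tau).
apply: smallest_sub; first exact: smallest_sigma_algebra.
move=> U oU.
have [Ua|Ua] := pselect (U a); last by apply: sub_gen_smallest; exact: st.
have ba : borel tau [set a].
  by rewrite -(setCK [set a]) -setTD; apply: bD; exact: sub_gen_smallest.
have bUa : borel tau (U `&` ~` [set a]).
  by apply: sub_gen_smallest; apply: st; [case=> _; apply|exact: opensI].
have -> : U = \bigcup_i bigcup2 (U `&` ~` [set a]) [set a] i.
  rewrite bigcup2E; apply/seteqP; split=> x.
    by move=> Ux; have [->|xa] := pselect (x = a); [right|left].
  by case=> [[]//|->].
by apply: bU => -[//|[//|i]].
Qed.

Lemma separable_transfer tau sigma :
  (forall U, ~ U a -> opens sigma U -> opens tau U) ->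
  separable (Defs.space tau) -> separable (Defs.space sigma).
Proof.
move=> st [D [cD dD]]; exists (D `|` [set a]); split.
  rewrite -bigcup2E; apply: bigcup_countable; first exact: countableP.
  by move=> [|[|i]] _ //=.
move=> U U0 oU; have [Ua|Ua] := pselect (U a).
  by exists a; split=> //; right.
by have [x [Ux Dx]] := dD U U0 (st _ Ua oU); exists x; split=> //; left.
Qed.

Lemma completely_metrizable_transfer tau sigma :
  metrizable R sigma ->
  opens tau (~` [set a]) ->
  (forall U, ~ U a -> opens tau U <-> opens sigma U) ->
  completely_metrizable R tau -> completely_metrizable R sigma.
Proof.
move=> [n nE] oa ts [m [mE mc]].
have oa' : opens sigma (~` [set a]) by apply/ts => //; apply.
have mn x A : x <> a ->
    @nbhs _ (metric_space m) x A <-> @nbhs _ (metric_space n) x A.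
  move=> xa; rewrite !nbhsE; split=> -[B [oB Bx] BA];
  exists (B `&` ~` [set a]) => //; try by move=> y [/BA].
  - split; last by split.
    by rewrite -[open _]/(metric_opens n _) nE; apply/ts; [case=> _; apply|
      apply: opensI => //; rewrite -mE].
  - split; last by split.
    by rewrite -[open _]/(metric_opens m _) mE; apply/ts; [case=> _; apply|
      apply: opensI => //; rewrite -nE].
exists (glued_metric a m n); split; first by rewrite glued_metric_opens.
exact: glued_metric_complete.
Qed.

End AwayFromPoint.

Theorem proposition4p5 (R : realType) (X : Type) (a : X)
    (tau sigma : topology X)
    (tau_metrizable : metrizable R tau)
    (sigma_metrizable : metrizable R sigma)
    (tau_sigma : subspace_opens tau (~` [set a]) =
                 subspace_opens sigma (~` [set a])) :
  [/\ borel tau = borel sigma,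
      completely_metrizable R tau <-> completely_metrizable R sigma &
      polish R tau <-> polish R sigma].
Proof.
have oat := metrizable_opensC1 a tau_metrizable.
have oas := metrizable_opensC1 a sigma_metrizable.
have ts U (Ua : ~ U a) : opens tau U -> opens sigma U.
  exact: opens_subspaceC1 oas tau_sigma Ua.
have st U (Ua : ~ U a) : opens sigma U -> opens tau U.
  exact: opens_subspaceC1 oat (esym tau_sigma) Ua.
have cts : completely_metrizable R tau <-> completely_metrizable R sigma.
  by split; apply: (@completely_metrizable_transfer R X a) => // U Ua;
    split; [exact: ts|exact: st|exact: st|exact: ts].
split=> //.
  by apply/seteqP; split; apply: (@borel_sub X a).
by split=> -[sep /cts c]; split=> //; exact: (separable_transfer (a := a)) sep.
Qed.
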